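(* Let $n,t$ be positive integers with $n\ge\max\{t^2+t+1,5t\}$. Let $V_1,V_2,V_3$ be disjoint sets of size $n$. For $i\in\{1,2,3\}$ let $A_i\subseteq V_i$ with $|A_i|=n-2t$ and $B_i=V_i\setminus A_i$, and let $B_1=\overline{B_2}\cup\overline{B_3}$ be a partition of $B_1$ with $|\overline{B_2}|=|\overline{B_3}|=t$. Consider a tripartite graph $G$ with vertex classes $V_1,V_2,V_3$ whose edges are exactly the following: every vertex of $A_1$ is joined to every vertex of $A_2\cup A_3$; for $j\in\{2,3\}$, every vertex of $\overline{B_j}$ is joined to every vertex of $V_j$; for $(i,j)\in\{(2,3),(3,2)\}$, every vertex of $B_i$ is joined to every vertex of $V_j$; and for $(i,j)\in\{(2,3),(3,2)\}$, every vertex of $\overline{B_i}$ is joined to exactly $t$ vertices of $A_j$, in such a way that any two distinct vertices of $\overline{B_i}$ have at most $1$ common neighbor in $A_j$. Then such a graph $G$ exists, and any such $G$ has minimum degree $n+t$ and contains no copy of $K_3(2)$ as a subgraph. In particular, choosing $t=(1-o(1))n^{\frac12}$ as $n\to\infty$ gives $K_3(2)$-free balanced tripartite graphs with parts of size $n$ and minimum degree $n+(1-o(1))n^{\frac12}$.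
   Context: $K_3(2)$ denotes the complete tripartite graph with three parts of size $2$ (the octahedral graph). A graph is $K_3(2)$-free if it does not contain $K_3(2)$ as a (not necessarily induced) subgraph. A tripartite graph with vertex classes $V_1,V_2,V_3$ has no edge inside any $V_i$; it is balanced if the classes have equal size. *)

(* Defs.v *)
From HB Require Import structures.
From mathcomp Require Import all_boot all_order all_algebra.
From mathcomp Require Import boolp classical_sets reals topology normedtype sequences.
Set Implicit Arguments.
Unset Strict Implicit.
Unset Printing Implicit Defensive.
Import Order.TTheory GRing.Theory Num.Theory.
Import numFieldNormedType.Exports.

Record sgraph (T : finType) := SGraph {
  adj :> rel T;
  adj_sym : symmetric adj;
  adj_irr : irreflexive adj }.

Definition neigh (T : finType) (G : sgraph T) (v : T) : {set T} :=
  [set w | G v w].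

Definition degree (T : finType) (G : sgraph T) (v : T) : nat := #|neigh G v|.

(* Every degree is at most #|T|, so the default value #|T| is harmless
   as soon as T is nonempty. *)
Definition min_degree (T : finType) (G : sgraph T) : nat :=
  \big[minn/#|T|]_(v : T) degree G v.

(* Containment as a subgraph that need not be induced. *)
Definition contains (S T : finType) (H : sgraph S) (G : sgraph T) : Prop :=
  exists f : S -> T, injective f /\ forall x y, H x y -> G (f x) (f y).

Section CompleteMultipartite.
Variables r s : nat.

Definition multipartite_rel : rel ('I_r * 'I_s) := fun x y => x.1 != y.1.

Lemma multipartite_sym : symmetric multipartite_rel.
Proof. by move=> x y; rewrite /multipartite_rel eq_sym. Qed.

Lemma multipartite_irr : irreflexive multipartite_rel.
Proof. by move=> x; rewrite /multipartite_rel eqxx. Qed.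

(* K_r(s): r parts of size s; the first coordinate is the part. *)
Definition complete_multipartite : sgraph ('I_r * 'I_s)%type :=
  SGraph multipartite_sym multipartite_irr.
End CompleteMultipartite.

Definition K3_2 := complete_multipartite 3 2.

Definition K3_2_free (T : finType) (G : sgraph T) : Prop := ~ contains K3_2 G.

Definition three_classes (T : finType) (V1 V2 V3 : {set T}) : Prop :=
  [/\ V1 :|: V2 :|: V3 = [set: T],
      [disjoint V1 & V2], [disjoint V1 & V3] & [disjoint V2 & V3]].

Definition no_edge_inside (T : finType) (G : sgraph T) (V : {set T}) : Prop :=
  forall x y, x \in V -> y \in V -> ~~ G x y.

Definition tripartite (T : finType) (G : sgraph T) (V1 V2 V3 : {set T}) : Prop :=
  three_classes V1 V2 V3 /\
  [/\ no_edge_inside G V1, no_edge_inside G V2 & no_edge_inside G V3].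

Definition balanced_tripartite (T : finType) (G : sgraph T) (n : nat) : Prop :=
  exists V1 V2 V3 : {set T},
    tripartite G V1 V2 V3 /\ [/\ #|V1| = n, #|V2| = n & #|V3| = n].

(* The vertex sets of the construction; T is the disjoint union of the three
   classes.  The set Bbar j is the part of B1 that is completely joined to V j. *)
Record vertex_setup (T : finType) (n t : nat) := VertexSetup {
  V1 : {set T}; V2 : {set T}; V3 : {set T};
  A1 : {set T}; A2 : {set T}; A3 : {set T};
  Bbar2 : {set T}; Bbar3 : {set T};
  setup_classes : three_classes V1 V2 V3;
  card_V : [/\ #|V1| = n, #|V2| = n & #|V3| = n];
  sub_A : [/\ A1 \subset V1, A2 \subset V2 & A3 \subset V3];
  card_A : [/\ #|A1| = n - 2 * t, #|A2| = n - 2 * t & #|A3| = n - 2 * t];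
  Bbar_cover : Bbar2 :|: Bbar3 = V1 :\: A1;
  Bbar_disjoint : [disjoint Bbar2 & Bbar3];
  card_Bbar : #|Bbar2| = t /\ #|Bbar3| = t }.

Section Construction.
Variables (T : finType) (n t : nat) (S : vertex_setup T n t).

Definition B2 : {set T} := V2 S :\: A2 S.
Definition B3 : {set T} := V3 S :\: A3 S.

Definition complete_pair : rel T := fun x y =>
  [|| (x \in A1 S) && (y \in A2 S :|: A3 S),
      (x \in Bbar2 S) && (y \in V2 S),
      (x \in Bbar3 S) && (y \in V3 S),
      (x \in B2) && (y \in V3 S) |
      (x \in B3) && (y \in V2 S)].

Definition sparse_pair : rel T := fun x y =>
  (x \in Bbar2 S) && (y \in A3 S) || (x \in Bbar3 S) && (y \in A2 S).

Definition sparsely_joined (G : sgraph T) (X Y : {set T}) : Prop :=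
  (forall x, x \in X -> #|neigh G x :&: Y| = t) /\
  (forall x x', x \in X -> x' \in X -> x != x' ->
     #|neigh G x :&: neigh G x' :&: Y| <= 1).

Definition construction (G : sgraph T) : Prop :=
  [/\ tripartite G (V1 S) (V2 S) (V3 S),
      forall x y, complete_pair x y -> G x y,
      forall x y, G x y ->
        [|| complete_pair x y, complete_pair y x,
            sparse_pair x y | sparse_pair y x],
      sparsely_joined G (Bbar2 S) (A3 S) &
      sparsely_joined G (Bbar3 S) (A2 S)].
End Construction.

Local Open Scope classical_set_scope.
Local Open Scope ring_scope.

(* f n = (1 - o(1)) n^(1/2) as n tends to infinity. *)
Definition one_minus_o1_sqrt (R : realType) (f : nat -> R) : Prop :=
  exists eps : nat -> R,
    eps @ \oo --> (0 : R) /\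
    \forall n \near \oo, f n = (1 - eps n) * Num.sqrt n%:R.

(* Main.v *)
Require Import Defs.
From mathcomp Require Import all_boot all_order all_algebra.
From mathcomp Require Import boolp classical_sets reals topology normedtype sequences.
From mathcomp Require Import zify lra.
From mathcomp Require Import fintype finset.
Set Implicit Arguments.
Unset Strict Implicit.
Unset Printing Implicit Defensive.
Import Order.TTheory GRing.Theory Num.Theory.
Import numFieldNormedType.Exports.

(** Minimum degree.  A vertex of [Bbar2] sees exactly the [n] vertices of [V2]
    and [t] vertices of [A3], so its degree is [n + t].  No vertex does worse:
    one of [A1] has degree at least [2 * (n - 2 * t)], which is where
    [5 * t <= n] enters, and one of [V2] has at least [n + t] neighbors among
    the completely joined pairs alone.  The construction is invariant under
    exchanging the indices 2 and 3 ([construction_swap]), which settles the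
    remaining vertices.

    Octahedra.  A proper 3-colouring of the octahedron is constant on its three
    parts, so a copy of it consists of two vertices in each class
    ([octahedron_in_classes]).  Between [V2] and [V3] every edge meets [B2] or
    [B3]; by symmetry the copy contains some [z] in [B3].  The neighbors of [z]
    in [V1] all lie in [Bbar3], and two vertices of [Bbar3] have at most one
    common neighbor in [V2], whereas the octahedron asks for two
    ([no_common_neighbor_in_B3]).

    Existence.  The sparse pairs need [t] sets of size [t], pairwise meeting in
    at most one point, inside a set of size [n - 2 * t].  The stars of the
    complete graph on [t + 1] vertices, viewed as sets of edges, have this
    property and need only ['C(t + 1, 2)] points ([exists_sparse_family]); this
    is at most [t ^ 2 - t + 1], because [(t - 1) * (t - 2) >= 0].

    Asymptotics.  One less than the integer part of the square root of [n]
    satisfies the size condition and is within 2 of the square root; any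
    function at bounded distance from the square root is [(1 - o(1))] times it
    ([one_minus_o1_sqrt_bounded_gap]). *)

(** * Sparse families of sets *)

Lemma exists_injection_into (I T : finType) (D : {set I}) (A : {set T}) (x0 : T) :
  #|D| <= #|A| -> exists2 f : I -> T, {in D &, injective f} & f @: D \subset A.
Proof.
move=> leDA.
have lt_index i : i \in D -> index i (enum D) < size (enum A).
  by move=> Di; rewrite -cardE; apply: leq_trans leDA; rewrite cardE index_mem mem_enum.
exists (fun i => nth x0 (enum A) (index i (enum D))).
  move=> i j Di Dj /eqP; rewrite nth_uniq ?enum_uniq ?lt_index // => /eqP.
  by move/index_inj; rewrite !mem_enum; apply.
by apply/subsetP => _ /imsetP[i Di ->]; rewrite -mem_enum mem_nth ?lt_index.
Qed.

Lemma card_disjointU (T : finType) (A B : {set T}) :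
  [disjoint A & B] -> #|A :|: B| = #|A| + #|B|.
Proof. by move=> dAB; apply/eqP; rewrite (leq_card_setU A B).2. Qed.

(** The edges at [i] in the complete graph on [I]. *)
Definition star (I : finType) (i : I) : {set {set I}} :=
  [set e : {set I} | (#|e| == 2) && (i \in e)].

Lemma card_star (I : finType) (i : I) : #|star i| = #|I|.-1.
Proof.
rewrite -(cardsC1 i) -(card_in_imset (f := fun j => [set i; j])).
  apply: eq_card => e; rewrite inE; apply/andP/imsetP.
    case=> /cards2P[a [b [neq_ab ->]]]; rewrite !inE => /orP[]/eqP eq_i.
      by exists b; rewrite ?inE eq_i // eq_sym.
    by exists a; rewrite ?inE eq_i // setUC.
  by case=> j; rewrite !inE eq_sym => neq_ij ->; rewrite cards2 neq_ij !inE eqxx.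
move=> j k; rewrite !inE => neq_ji _ /setP/(_ j).
by rewrite !inE eqxx orbT (negPf neq_ji) => /esym/eqP.
Qed.

(** Only the edge joining [i] and [j] lies at both of them. *)
Lemma card_starI (I : finType) (i j : I) : i != j -> #|star i :&: star j| <= 1.
Proof.
move=> neq_ij; rewrite -(cards1 [set i; j]); apply/subset_leq_card/subsetP => e.
rewrite !inE => /andP[/andP[/eqP card_e ei] /andP[_ ej]]; rewrite eq_sym.
by rewrite eqEcard card_e cards2 neq_ij subUset !sub1set ei ej.
Qed.

(** [X] is embedded in the vertices and [Y] receives the edges of the complete
    graph on [t + 1] vertices; [N x] is the image of the star of [x]. *)
Lemma exists_sparse_family (T : finType) (X Y : {set T}) (t : nat) :
  0 < t -> #|X| <= t.+1 -> 'C(t.+1, 2) <= #|Y| ->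
  exists N : T -> {set T},
    [/\ forall x, N x \subset Y, forall x, #|N x| = t &
        forall x x', x \in X -> x' \in X -> x != x' -> #|N x :&: N x'| <= 1].
Proof.
move=> t_gt0 leX leY.
have /card_gt0P[y0 _] : 0 < #|Y| by apply: leq_trans leY; rewrite bin_gt0 ltnS.
have [|g g_inj _] := @exists_injection_into T 'I_t.+1 X [set: 'I_t.+1] ord0.
  by rewrite cardsT card_ord.
pose D := [set e : {set 'I_t.+1} | #|e| == 2].
have [|f f_inj fD] := @exists_injection_into _ T D Y y0.
  by rewrite card_draws card_ord.
have starD i : star i \subset D by apply/subsetP => e; rewrite !inE => /andP[].
have f_inj2 i j : {in star i & star j, injective f}.
  by move=> e e' /(subsetP (starD i)) De /(subsetP (starD j)); apply: f_inj.
exists (fun x => f @: star (g x)); split=> [x|x|x x' Xx Xx' neq_xx'].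
- by apply: subset_trans fD; apply: imsetS.
- by rewrite card_in_imset ?card_star ?card_ord //; apply: f_inj2.
- rewrite -imsetI; last exact: f_inj2.
  apply: leq_trans (leq_imset_card _ _) (card_starI _).
  by apply: contra_neq neq_xx'; apply: g_inj.
Qed.

(** * Minimum degree and copies of the octahedron *)

Lemma min_degree_eq (T : finType) (G : sgraph T) (m : nat) (v0 : T) :
  (forall v, m <= degree G v) -> degree G v0 = m -> min_degree G = m.
Proof.
move=> le_m deg_v0; apply/eqP; rewrite eqn_leq /min_degree -minEnat -!leEnat.
apply/andP; split; first by rewrite -deg_v0 bigmin_le.
apply: le_bigmin => [|v _]; last exact: le_m.
by rewrite leEnat -deg_v0 max_card.
Qed.

(** One vertex from each part spans a complete graph on [r] vertices, which uses
    every colour once.  Any other vertex of part [i] is adjacent to the chosen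
    vertices of the other parts, so only the colour of part [i] is left. *)
Lemma coloring_complete_multipartite (r s : nat) (T : finType) (G : sgraph T)
    (c : T -> 'I_r) (f : 'I_r * 'I_s.+1 -> T) :
  (forall x y, G x y -> c x != c y) ->
  (forall x y, complete_multipartite r s.+1 x y -> G (f x) (f y)) ->
  exists2 p : 'I_r -> 'I_r, injective p & forall k e, c (f (p k, e)) = k.
Proof.
move=> c_proper f_hom.
pose g i := c (f (i, ord0)).
have g_inj : injective g.
  move=> i j eq_g; apply/eqP; apply: contraTT isT => neq_ij.
  by have := c_proper _ _ (f_hom (i, ord0) (j, ord0) neq_ij); rewrite -/(g i) eq_g eqxx.
exists (invF g_inj) => [|k e]; first exact: (can_inj (f_invF g_inj)).
set i := invF g_inj k; set j := invF g_inj (c (f (i, e))).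
have gj : g j = c (f (i, e)) by apply: f_invF.
have [eq_ij|neq_ij] := eqVneq i j; first by rewrite -gj -eq_ij /i f_invF.
by have := c_proper _ _ (f_hom (i, e) (j, ord0) neq_ij); rewrite -gj eqxx.
Qed.

Lemma octahedron_in_classes (T : finType) (G : sgraph T) (U1 U2 U3 : {set T}) :
  tripartite G U1 U2 U3 -> contains K3_2 G ->
  exists x x' y y' z z' : T,
    [/\ [/\ x \in U1, x' \in U1 & x != x'], [/\ y \in U2, y' \in U2 & y != y'],
        [/\ z \in U3, z' \in U3 & z != z'] &
        [/\ [/\ G x y, G x y', G x' y & G x' y'],
            [/\ G x z, G x z', G x' z & G x' z'] &
            [/\ G y z, G y z', G y' z & G y' z']]].
Proof.
move=> [[cover d12 d13 d23] [in1 in2 in3]] [f [f_inj f_hom]].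
pose c x : 'I_3 := if x \in U1 then inord 0 else if x \in U2 then inord 1 else inord 2.
have notU12 x : x \notin U1 -> x \notin U2 -> x \in U3.
  by move=> /negPf N1 /negPf N2; move/setP/(_ x): cover; rewrite !inE N1 N2.
have eqF k l : k < 3 -> l < 3 -> k != l -> (inord k == inord l :> 'I_3) = false.
  by move=> k3 l3 /negPf; rewrite -val_eqE /= !inordK.
have c1 x : c x = inord 0 -> x \in U1.
  by move/eqP; rewrite /c; case: ifP => // _; case: ifP; rewrite eqF.
have c2 x : c x = inord 1 -> x \in U2.
  by move/eqP; rewrite /c; case: ifP => [_|_]; [|case: ifP => // _]; rewrite eqF.
have c3 x : c x = inord 2 -> x \in U3.
  move/eqP; rewrite /c; case: ifP => [_|/negbT N1]; first by rewrite eqF.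
  by case: ifP => [_|/negbT N2 _]; [rewrite eqF | apply: notU12].
have c_proper x y : G x y -> c x != c y.
  move=> Gxy; apply: contraTneq Gxy => cxy.
  have [cx|] := eqVneq (c x) (inord 0); first by apply: in1; apply: c1; rewrite -?cxy.
  have [cx _|] := eqVneq (c x) (inord 1); first by apply: in2; apply: c2; rewrite -?cxy.
  move=> N2 N1; have cx : c x = inord 2.
    by move: N1 N2; rewrite /c; case: ifP; rewrite ?eqxx //; case: ifP; rewrite ?eqxx.
  by apply: in3; apply: c3; rewrite -?cxy.
(* [p k] is the part of the octahedron that lands in the class of colour [k]. *)
have [p p_inj pE] := coloring_complete_multipartite c_proper f_hom.
have adjf k l e e' : k != l -> G (f (p k, e)) (f (p l, e')).
  by move=> neq_kl; apply: f_hom; rewrite /= /multipartite_rel /= (inj_eq p_inj).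
have neqf i : f (i, ord0) != f (i, ord_max) by rewrite (inj_eq f_inj) xpair_eqE eqxx.
exists (f (p (inord 0), ord0)), (f (p (inord 0), ord_max)),
       (f (p (inord 1), ord0)), (f (p (inord 1), ord_max)),
       (f (p (inord 2), ord0)), (f (p (inord 2), ord_max)).
split; [by split; rewrite ?neqf //; apply: c1; rewrite pE
       |by split; rewrite ?neqf //; apply: c2; rewrite pE
       |by split; rewrite ?neqf //; apply: c3; rewrite pE|].
by split; split; apply: adjf; rewrite eqF.
Qed.

(** * Regions and symmetry of the construction *)

Section Setup.
Variables (T : finType) (n t : nat).
Implicit Types (S : vertex_setup T n t) (G : sgraph T).

(** The seven regions partition the vertices, and the region of [x] determines
    its membership in all ten sets of the setup, listed in the order of
    [regionP].  Case analysis on [regionP] then decides whether two vertices can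
    be adjacent by computation. *)
Variant region_spec : bool -> bool -> bool -> bool -> bool -> bool ->
    bool -> bool -> bool -> bool -> Prop :=
  | RegionA1 : region_spec true false false true false false false false false false
  | RegionBbar2 : region_spec true false false false false false true false false false
  | RegionBbar3 : region_spec true false false false false false false true false false
  | RegionA2 : region_spec false true false false true false false false false false
  | RegionB2 : region_spec false true false false false false false false true false
  | RegionA3 : region_spec false false true false false true false false false false
  | RegionB3 : region_spec false false true false false false false false false true.

Lemma regionP S x :
  region_spec (x \in V1 S) (x \in V2 S) (x \in V3 S)
    (x \in A1 S) (x \in A2 S) (x \in A3 S)
    (x \in Bbar2 S) (x \in Bbar3 S) (x \in B2 S) (x \in B3 S).
Proof.
have [/setP/(_ x) cover d12 d13 d23] := setup_classes S.
have [/subsetP/(_ x)/implyP sA1 /subsetP/(_ x)/implyP sA2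
      /subsetP/(_ x)/implyP sA3] := sub_A S.
have /setP/(_ x) coverB := Bbar_cover S.
have notboth (U W : {set T}) : [disjoint U & W] -> ~~ ((x \in U) && (x \in W)).
  by move=> dUW; apply/andP => -[xU]; rewrite (disjointFr dUW).
move: cover coverB sA1 sA2 sA3 (notboth _ _ d12) (notboth _ _ d13) (notboth _ _ d23)
  (notboth _ _ (Bbar_disjoint S)).
rewrite !inE.
by case: (x \in V1 S); case: (x \in V2 S); case: (x \in V3 S); case: (x \in A1 S);
   case: (x \in A2 S); case: (x \in A3 S); case: (x \in Bbar2 S);
   case: (x \in Bbar3 S) => //= *; constructor.
Qed.

(** The same vertices with the roles of the indices 2 and 3 exchanged. *)
Definition swap_setup S : vertex_setup T n t.
Proof.
refine (@VertexSetup T n t (V1 S) (V3 S) (V2 S) (A1 S) (A3 S) (A2 S) (Bbar3 S) (Bbar2 S)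
          _ _ _ _ _ _ _).
- have [cover d12 d13 d23] := setup_classes S.
  by split=> //; [rewrite -setUA (setUC (V3 S)) setUA | rewrite disjoint_sym].
- by have [c1 c2 c3] := card_V S.
- by have [s1 s2 s3] := sub_A S.
- by have [c1 c2 c3] := card_A S.
- by rewrite setUC; apply: Bbar_cover.
- by rewrite disjoint_sym; apply: Bbar_disjoint.
- by have [c1 c2] := card_Bbar S.
Defined.

Lemma construction_swap S G : construction S G -> construction (swap_setup S) G.
Proof.
have complete_swap x y : complete_pair (swap_setup S) x y = complete_pair S x y.
  rewrite /complete_pair /=; rewrite -/(B2 S) -/(B3 S) (setUC (A3 S)).
  by congr orb; rewrite orbCA; do 2 congr orb; apply: orbC.
have sparse_swap x y : sparse_pair (swap_setup S) x y = sparse_pair S x y.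
  exact: orbC.
case=> [[classes [in1 in2 in3]] complete edges sparse2 sparse3]; split=> //.
- by split=> //; apply: (setup_classes (swap_setup S)).
- by move=> x y; rewrite complete_swap; apply: complete.
- by move=> x y; rewrite !complete_swap !sparse_swap; apply: edges.
Qed.

(** * The minimum degree is [n + t] *)

Lemma subset_degree G v (U : {set T}) : (forall w, w \in U -> G v w) -> #|U| <= degree G v.
Proof. by move=> UG; apply/subset_leq_card/subsetP => w /UG; rewrite inE. Qed.

Lemma complete_sym S G x y : construction S G ->
  complete_pair S x y || complete_pair S y x -> G x y.
Proof. by case=> _ complete _ _ _ /orP[]/complete //; rewrite adj_sym. Qed.

(** The three sets are completely joined to the vertices of [A1], [A2] and [B2]
    respectively, and bound their degrees from below. *)
Lemma card_region S : 5 * t <= n ->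
  [/\ #|A2 S :|: A3 S| = 2 * (n - 2 * t), #|A1 S :|: Bbar2 S :|: B3 S| = n + t &
      #|V3 S :|: Bbar2 S| = n + t].
Proof.
move=> le_n.
have [cV1 cV2 cV3] := card_V S; have [cA1 cA2 cA3] := card_A S.
have [cb2 cb3] := card_Bbar S; have [sA1 sA2 sA3] := sub_A S.
have cB3 : #|B3 S| = 2 * t.
  by rewrite cardsD (setIidPr sA3) cV3 cA3; lia.
rewrite !card_disjointU ?cA1 ?cA2 ?cA3 ?cV3 ?cb2 ?cB3; first by split; lia.
all: by apply/pred0P => x /=; rewrite ?[x \in _ :|: _]inE; case: (regionP S x).
Qed.

Lemma degree_Bbar2 S G x : construction S G -> x \in Bbar2 S -> degree G x = n + t.
Proof.
move=> cG xB; have [_ _ edges [deg2 _] _] := cG.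
have -> : degree G x = #|V2 S :|: (neigh G x :&: A3 S)|.
  apply: eq_card => y; rewrite !inE.
  apply/idP/idP => [Gxy|/orP[yV|/andP[//]]].
    move: (edges _ _ Gxy) xB; rewrite /complete_pair /sparse_pair !inE Gxy.
    by case: (regionP S x); case: (regionP S y).
  by apply: (complete_sym cG); rewrite /complete_pair xB yV !orbT.
rewrite card_disjointU ?deg2 //; first by have [_ -> _] := card_V S.
by apply/pred0P => y /=; rewrite !inE; case: (regionP S y); rewrite ?andbF.
Qed.

Lemma degree_V1 S G x : construction S G -> 5 * t <= n -> x \in V1 S -> n + t <= degree G x.
Proof.
move=> cG le_n xV1.
have [xA|xA] := boolP (x \in A1 S).
  have [cA _ _] := card_region S le_n.
  apply: (@leq_trans #|A2 S :|: A3 S|); first by rewrite cA; lia.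
  by apply: subset_degree => y yA; apply: (complete_sym cG); rewrite /complete_pair xA yA.
have [xb2|xb2] := boolP (x \in Bbar2 S); first by rewrite (degree_Bbar2 cG).
rewrite (degree_Bbar2 (construction_swap cG)) //=.
by move: xV1 xA xb2; case: (regionP S x).
Qed.

Lemma degree_V2 S G x : construction S G -> 5 * t <= n -> x \in V2 S -> n + t <= degree G x.
Proof.
move=> cG le_n xV2; have [_ cA cB] := card_region S le_n.
have [xA|xA] := boolP (x \in A2 S); [rewrite -cA|rewrite -cB];
  apply: subset_degree => y; rewrite 2?inE => yU; apply: (complete_sym cG); move: xV2 xA yU;
  rewrite /complete_pair 2![_ \in _ :|: _]inE;
  by case: (regionP S x); case: (regionP S y).
Qed.

(** The vertices of [V3] are those of [V2] in the swapped setup. *)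
Lemma degree_ge S G x : construction S G -> 5 * t <= n -> n + t <= degree G x.
Proof.
move=> cG le_n; have [V1x|V1x] := boolP (x \in V1 S); first exact: degree_V1 cG _ _.
have [V2x|V2x] := boolP (x \in V2 S); first exact: degree_V2 cG _ _.
apply: (degree_V2 (construction_swap cG)) => //=.
by move: V1x V2x; case: (regionP S x).
Qed.

Lemma min_degree_construction S G :
  construction S G -> 0 < t -> 5 * t <= n -> min_degree G = n + t.
Proof.
move=> cG t_gt0 le_n; have [cb2 _] := card_Bbar S.
have /card_gt0P[v0 v0b2] : 0 < #|Bbar2 S| by rewrite cb2.
apply: (min_degree_eq (v0 := v0)); last exact: degree_Bbar2 cG _.
by move=> v; apply: degree_ge cG _.
Qed.

(** * The construction contains no octahedron *)

(** A neighbor of [z] in [V1] would lie in [Bbar3], since [A1] and [Bbar2] are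
    joined to no vertex of [B3].  In [V2] a vertex of [Bbar3] is joined only to
    vertices of [A2], so [y] and [y'] would be two common neighbors there. *)
Lemma no_common_neighbor_in_B3 S G x x' y y' z : construction S G ->
  x \in V1 S -> x' \in V1 S -> x != x' -> y \in V2 S -> y' \in V2 S -> y != y' ->
  G x y -> G x y' -> G x' y -> G x' y' -> G x z -> G x' z -> z \notin B3 S.
Proof.
move=> [_ _ edges _ [_ sparse3]] xV1 x'V1 neq_xx' yV2 y'V2 neq_yy' Gxy Gxy' Gx'y Gx'y' Gxz Gx'z.
apply/negP => zB3.
have inBbar3 u : u \in V1 S -> G u z -> u \in Bbar3 S.
  move=> uV1 /edges; move: uV1 zB3; rewrite /complete_pair /sparse_pair !inE.
  by case: (regionP S u); case: (regionP S z).
have xb3 := inBbar3 _ xV1 Gxz; have x'b3 := inBbar3 _ x'V1 Gx'z.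
have inA2 v : v \in V2 S -> G x v -> v \in A2 S.
  move=> vV2 /edges; move: xb3 vV2; rewrite /complete_pair /sparse_pair !inE.
  by case: (regionP S x); case: (regionP S v).
have := sparse3 _ _ xb3 x'b3 neq_xx'; rewrite leqNgt => /negP; apply.
have <- : #|[set y; y']| = 2 by rewrite cards2 neq_yy'.
by apply/subset_leq_card; rewrite subUset !sub1set !inE Gxy Gxy' Gx'y Gx'y' !inA2.
Qed.

(** An edge from [V2] to [V3] cannot join [A2] to [A3]: it ends in [B3] or
    starts in [B2], and the second case is the first one in the swapped setup. *)
Lemma construction_K3_2_free S G : construction S G -> K3_2_free G.
Proof.
move=> cG; have [trip _ edges _ _] := cG.
case/(octahedron_in_classes trip) => x [x' [y [y' [z [z']]]]].
move=> [[xV x'V nx] [yV y'V ny] [zV z'V nz]].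
move=> [[xy xy' x'y x'y'] [xz xz' x'z x'z'] [yz _ _ _]].
have [zB|zB] := boolP (z \in B3 S).
  by have /negP := no_common_neighbor_in_B3 cG xV x'V nx yV y'V ny xy xy' x'y x'y' xz x'z.
have [yB|yB] := boolP (y \in B2 S).
  by have /negP := no_common_neighbor_in_B3 (construction_swap cG)
       xV x'V nx zV z'V nz xz xz' x'z x'z' xy x'y.
move: (edges _ _ yz) yV zV zB yB; rewrite /complete_pair /sparse_pair !inE.
by case: (regionP S y); case: (regionP S z).
Qed.

(** * Existence of the construction *)

Lemma exists_construction S :
  0 < t -> t ^ 2 + t + 1 <= n -> exists G : sgraph T, construction S G.
Proof.
move=> t_gt0 le_n.
(* The difference of the two sides is at least (t - 1) * (t - 2) / 2. *)
have bin_le : 'C(t.+1, 2) <= n - 2 * t.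
  by rewrite bin2 /= leq_half_double -muln2; nia.
have [cA1 cA2 cA3] := card_A S; have [cb2 cb3] := card_Bbar S.
have [||N2 [N2Y N2c N2I]] := @exists_sparse_family T (Bbar2 S) (A3 S) t t_gt0.
- by rewrite cb2.
- by rewrite cA3.
have [||N3 [N3Y N3c N3I]] := @exists_sparse_family T (Bbar3 S) (A2 S) t t_gt0.
- by rewrite cb3.
- by rewrite cA2.
(* Each edge is oriented as in [complete_pair] and [sparse_pair]. *)
pose arc x y := [|| complete_pair S x y, (x \in Bbar2 S) && (y \in N2 x) |
                   (x \in Bbar3 S) && (y \in N3 x)].
have arc_pair x y : arc x y -> complete_pair S x y || sparse_pair S x y.
  rewrite /arc /sparse_pair => /or3P[->//|/andP[-> /(subsetP (N2Y x))->]|].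
    by rewrite !orbT.
  by move=> /andP[-> /(subsetP (N3Y x))->]; rewrite !orbT.
have no_arc_inside (U : {set T}) x y : U \in [:: V1 S; V2 S; V3 S] ->
    x \in U -> y \in U -> ~~ arc x y.
  move=> U_in xU yU; apply/negP => /arc_pair; move: U_in xU yU.
  rewrite /complete_pair /sparse_pair !inE => /or3P[]/eqP->;
  by case: (regionP S x); case: (regionP S y).
pose e x y := arc x y || arc y x.
have e_sym : symmetric e by move=> x y; apply: orbC.
have inside U : U \in [:: V1 S; V2 S; V3 S] -> forall x y, x \in U -> y \in U -> ~~ e x y.
  by move=> U_in x y xU yU; rewrite negb_or !(no_arc_inside U).
have e_irr : irreflexive e.
  move=> x; apply/negbTE.
  have [cover _ _ _] := setup_classes S; move/setP/(_ x): cover; rewrite !inE.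
  by move=> /orP[/orP[]|] xU; apply: (inside _ _ _ _ xU xU); rewrite !inE eqxx ?orbT.
have neigh2 x : x \in Bbar2 S -> neigh (SGraph e_sym e_irr) x :&: A3 S = N2 x.
  move=> xB; apply/setP => y; rewrite -(setIidPl (N2Y x)) !inE /= /e /arc /complete_pair !inE.
  by move: xB; case: (regionP S x); case: (regionP S y); rewrite ?andbT ?andbF ?orbF.
have neigh3 x : x \in Bbar3 S -> neigh (SGraph e_sym e_irr) x :&: A2 S = N3 x.
  move=> xB; apply/setP => y; rewrite -(setIidPl (N3Y x)) !inE /= /e /arc /complete_pair !inE.
  by move: xB; case: (regionP S x); case: (regionP S y); rewrite ?andbT ?andbF ?orbF.
exists (SGraph e_sym e_irr); split.
- split; first exact: setup_classes.
  by split; apply: inside; rewrite !inE eqxx ?orbT.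
- by move=> x y xy; rewrite /= /e /arc xy.
- by move=> x y /orP[]/arc_pair/orP[]->; rewrite ?orbT.
- split=> [x xB|x x' xB x'B neq]; first by rewrite neigh2.
  by rewrite -[A3 S]setIid setIACA !neigh2 // N2I.
- split=> [x xB|x x' xB x'B neq]; first by rewrite neigh3.
  by rewrite -[A2 S]setIid setIACA !neigh3 // N3I.
Qed.

End Setup.
(** * A vertex setup with given parameters *)

Section Grid.
Variable n : nat.

(** Rows of the grid are the vertex classes.  With the index range as a
    parameter, all sets of a setup are slabs and their inclusions and
    disjointness reduce to linear arithmetic. *)
Definition slab (k a b : nat) : {set 'I_3 * 'I_n} :=
  [set x : 'I_3 * 'I_n | (x.1 == k :> nat) && (a <= x.2 < b)].

Lemma card_slab k a b : k < 3 -> b <= n -> #|slab k a b| = b - a.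
Proof.
move=> lt_k le_b.
have -> : slab k a b = setX [set Ordinal lt_k] [set j : 'I_n | a <= j < b].
  by apply/setP => x; rewrite !inE.
rewrite cardsX cards1 mul1n -sum1dep_card -(big_mkord (fun j => a <= j < b) (fun=> 1)).
by rewrite -[b - a]muln1 -sum_nat_const_nat (big_nat_widenl a 0) // (big_nat_widen _ b n).
Qed.

Lemma grid_setup t : 2 * t <= n -> vertex_setup ('I_3 * 'I_n)%type n t.
Proof.
move=> le_t.
have disj k a b l a' b' : k != l -> [disjoint slab k a b & slab l a' b'].
  by move=> neq; apply/pred0P => x; rewrite /= !inE; lia.
have sub k b : b <= n -> slab k 0 b \subset slab k 0 n.
  by move=> le_b; apply/subsetP => x; rewrite !inE; lia.
apply: (@VertexSetup _ n t (slab 0 0 n) (slab 1 0 n) (slab 2 0 n)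
  (slab 0 0 (n - 2 * t)) (slab 1 0 (n - 2 * t)) (slab 2 0 (n - 2 * t))
  (slab 0 (n - 2 * t) (n - t)) (slab 0 (n - t) n)).
- split; rewrite ?disj //; apply/setP => -[i j]; rewrite !inE /=.
  by have := ltn_ord i; have := ltn_ord j; lia.
- by rewrite !card_slab ?subn0.
- by rewrite !sub ?leq_subr.
- by rewrite !card_slab ?subn0 ?leq_subr.
- by apply/setP => x; rewrite !inE; have := ltn_ord x.2; lia.
- by apply/pred0P => x; rewrite /= !inE; lia.
- by rewrite !card_slab ?leq_subr //; lia.
Qed.

End Grid.

(** * Asymptotics of the parameters *)

Local Open Scope classical_set_scope.

(** The relative error is at most [C] divided by the square root of [n], which
    drops below [e] once [n] exceeds [(C / e) ^+ 2]. *)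
Lemma one_minus_o1_sqrt_bounded_gap (R : realType) (f : nat -> R) (C : R) :
  (\forall n \near \oo, `|Num.sqrt n%:R - f n| <= C)%R -> one_minus_o1_sqrt f.
Proof.
move=> gap; exists (fun n => 1 - f n / Num.sqrt n%:R)%R.
have sqrt_gt0 n : 0 < n -> (0 < Num.sqrt (n%:R : R))%R by rewrite sqrtr_gt0 ltr0n.
split; last first.
  by near=> n; rewrite subKr divfK ?gt_eqF ?sqrt_gt0 //; near: n; apply: nbhs_infty_gt.
apply/cvgr0Pnorm_lt => e e_gt0; near=> n.
have n_gt0 : (0 < Num.sqrt (n%:R : R))%R.
  by apply: sqrt_gt0; near: n; apply: nbhs_infty_gt.
rewrite -{1}(divff (lt0r_neq0 n_gt0)) -mulrBl normrM normfV (gtr0_norm n_gt0).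
rewrite ltr_pdivrMr //; have gap_n : (`|Num.sqrt n%:R - f n| <= C)%R by near: n.
apply: (le_lt_trans gap_n); rewrite mulrC -ltr_pdivrMr //.
apply: (le_lt_trans (ler_norm _)); rewrite -sqrtr_sqr ltr_sqrt ?ltr0n //.
  by near: n; apply: nbhs_infty_gtr.
by near: n; apply: nbhs_infty_gt.
Unshelve. all: by end_near. Qed.

Lemma exists_sqrt_parameter (R : realType) : exists t : nat -> nat,
  one_minus_o1_sqrt (fun n => (t n)%:R%R : R) /\
  \forall n \near \oo, 0 < t n /\ maxn (t n ^ 2 + t n + 1) (5 * t n) <= n.
Proof.
pose s n := Num.truncn (Num.sqrt (n%:R : R)).
have s_itv n : ((s n)%:R <= Num.sqrt (n%:R : R) < (s n).+1%:R)%R.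
  by apply: truncn_itv; apply: sqrtr_ge0.
have sE n : s n ^ 2 <= n < (s n).+1 ^ 2.
  have /andP[le_s lt_s] := s_itv n.
  rewrite -(ler_nat R) -(ltr_nat R) !natrX -[n%:R%R in X in X && _](@sqr_sqrtr R) //.
  rewrite -[n%:R%R in X in _ && X](@sqr_sqrtr R) //.
  by rewrite ler_sqr ?ltr_sqr ?nnegrE ?sqrtr_ge0 // le_s lt_s.
(* With [s] the integer part of the square root and [t = s - 1], the quantity
   [t ^ 2 + t + 1 = s ^ 2 - s + 1] is at most [n]; with [s] itself it may exceed [n]. *)
exists (fun n => (s n).-1); split.
  apply: (@one_minus_o1_sqrt_bounded_gap R _ 2%R); near=> n.
  have /andP[le_s lt_s] := s_itv n.
  have s_gt0 : 0 < s n.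
    have n_gt0 : 0 < n by near: n; apply: nbhs_infty_gt.
    by have := sE n; nia.
  rewrite -[s n in X in (X <= _)%R]prednK // in le_s lt_s.
  move: le_s lt_s; rewrite -(prednK s_gt0) /= !mulrS => le_s lt_s.
  by rewrite ger0_norm; lra.
(* [5 * (s - 1) <= s ^ 2] holds for [5 <= s]. *)
near=> n; have n_ge : 25 <= n by near: n; apply: nbhs_infty_ge.
by have := sE n; rewrite geq_max; nia.
Unshelve. all: by end_near. Qed.

(** * The theorem *)

Theorem mainTheorem4 (R : realType) :
  (forall n t : nat, 0 < n -> 0 < t -> maxn (t ^ 2 + t + 1) (5 * t) <= n ->
     forall (T : finType) (S : vertex_setup T n t),
       (exists G : sgraph T, construction S G) /\
       (forall G : sgraph T, construction S G ->
          min_degree G = n + t /\ K3_2_free G)) /\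
  (exists t : nat -> nat,
     one_minus_o1_sqrt (fun n => (t n)%:R%R : R) /\
     \forall n \near \oo,
       0 < t n /\ maxn (t n ^ 2 + t n + 1) (5 * t n) <= n) /\
  (forall t : nat -> nat,
     one_minus_o1_sqrt (fun n => (t n)%:R%R : R) ->
     (\forall n \near \oo,
       0 < t n /\ maxn (t n ^ 2 + t n + 1) (5 * t n) <= n) ->
     exists d : nat -> nat,
       one_minus_o1_sqrt (fun n => ((d n)%:R - n%:R)%R : R) /\
       \forall n \near \oo,
         exists (T : finType) (S : vertex_setup T n (t n)) (G : sgraph T),
           [/\ construction S G, balanced_tripartite G n,
               K3_2_free G & min_degree G = d n]).
Proof.
split.
  move=> n t _ t_gt0; rewrite geq_max => /andP[le_n1 le_n2] T S.
  split=> [|G cG]; first exact: exists_construction.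
  by split; [apply: min_degree_construction cG _ _ | apply: construction_K3_2_free cG].
split; first exact: exists_sqrt_parameter.
move=> t t_sqrt t_near; exists (fun n => n + t n); split.
  suff -> : (fun n => (n + t n)%:R - n%:R)%R = (fun n => (t n)%:R : R)%R by [].
  by apply/funext => n; rewrite natrD addrC addKr.
near=> n.
have [t_gt0] : 0 < t n /\ maxn (t n ^ 2 + t n + 1) (5 * t n) <= n by near: n.
rewrite geq_max => /andP[le_n1 le_n2].
have S : vertex_setup ('I_3 * 'I_n)%type n (t n) by apply: grid_setup; lia.
have [G cG] := exists_construction S t_gt0 le_n1.
exists _, S, G; split=> //; first by have [trip _ _ _ _] := cG; exists (V1 S), (V2 S), (V3 S);
  split=> //; apply: card_V.
- exact: construction_K3_2_free cG.
- exact: min_degree_construction cG _ _.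
Unshelve. all: by end_near. Qed.
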